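(* For integers $m,n$ with $2\le m\le n$, set $$D(m,n)=\begin{cases} m-2+\left\lceil\frac n2\right\rceil, & \text{if } n\ge 2m,\\ n-1, & \text{if } m\le n<2m.\end{cases}$$ Then for any $2\le m\le n$, every bipartite graph $G=(X,Y;E)$ with $|X|=m$, $|Y|=n$ and more than $mn-D(m,n)$ edges has positive Lin--Lu--Yau curvature, i.e. $\kappa_{\mathrm{LLY}}(x,y)>0$ for every edge $xy\in E$. Moreover, for any $2\le m\le n$ there exists a bipartite graph with parts of sizes $m$ and $n$ and exactly $mn-D(m,n)$ edges that contains an edge $xy$ with $\kappa_{\mathrm{LLY}}(x,y)\le 0$.
   Context: All graphs are finite and simple. Let $\rho$ denote graph distance and $d_x$ the degree of a vertex $x$. For probability measures $\mu_1,\mu_2$ on $V(G)$, the $L^1$-Wasserstein distance is $W(\mu_1,\mu_2)=\inf_\pi\sum_{u,v\in V}\rho(u,v)\pi(u,v)$, the infimum over $\pi:V\times V\to[0,1]$ with $\sum_v\pi(u,v)=\mu_1(u)$ for all $u$ and $\sum_u\pi(u,v)=\mu_2(v)$ for all $v$. For $\alpha\in[0,1]$ and a vertex $x$, $\mu_x^\alpha$ is the measure with $\mu_x^\alpha(x)=\alpha$, $\mu_x^\alpha(z)=\frac{1-\alpha}{d_x}$ if $z$ is adjacent to $x$, and $0$ otherwise. For an edge $xy$ (so $\rho(x,y)=1$), $\kappa_\alpha(x,y)=1-W(\mu_x^\alpha,\mu_y^\alpha)$ and the Lin--Lu--Yau curvature is $\kappa_{\mathrm{LLY}}(x,y)=\lim_{\alpha\to1^-}\frac{\kappa_\alpha(x,y)}{1-\alpha}$.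 (For edges, all the measures involved are supported in one connected component.) *)

(* Defs.v *)
From HB Require Import structures.
From mathcomp Require Import all_boot all_order all_algebra.
From mathcomp Require Import all_classical all_reals all_analysis.
From mathcomp Require Import lra.

Set Implicit Arguments.
Unset Strict Implicit.
Unset Printing Implicit Defensive.

Import Order.TTheory GRing.Theory Num.Theory.
Import numFieldNormedType.Exports.

Local Open Scope ring_scope.

Record sgraph : Type := SGraph {
  vertex :> finType;
  adj : rel vertex;
  adj_sym : symmetric adj;
  adj_irrefl : irreflexive adj
}.

Arguments adj {s}.

Section Graph.
Variable G : sgraph.
Implicit Types (x y u v : G) (X Y : {set G}).

Definition edges : {set {set G}} :=
  [set [set p.1; p.2]%SET | p in [set p : G * G | adj p.1 p.2]]%SET.

Definition bipartition X Y : Prop :=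
  [/\ (X :|: Y = [set: G])%SET,
      [disjoint X & Y] &
      forall u v, adj u v ->
        (u \in X /\ v \in Y) \/ (u \in Y /\ v \in X)].

Definition degree x : nat := #|[set z | adj x z]%SET|.

(* The least length of a walk from u to v. A shortest path has length less
   than #|G|; when v is not reachable from u, [find] returns #|G|. That value
   is irrelevant for the curvature of an edge, where the measures live on a
   single connected component. *)
Definition dist u v : nat :=
  find (fun k => [exists p : k.-tuple G, path adj u p && (last u p == v)])
       (iota 0 #|G|).

End Graph.

Section Curvature.
Local Open Scope classical_set_scope.
Variables (R : realType) (G : sgraph).
Implicit Types (x y u v z : G) (a : R) (mu nu : G -> R) (pi : G -> G -> R).

Definition coupling mu nu pi : Prop :=
  [/\ forall u v, 0 <= pi u v <= 1,
      forall u, \sum_v pi u v = mu u &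
      forall v, \sum_u pi u v = nu v].

Definition transport_cost pi : R :=
  \sum_u \sum_v (dist u v)%:R * pi u v.

Definition wasserstein mu nu : R :=
  inf [set transport_cost pi | pi in coupling mu nu].

Definition lazy_measure a x z : R :=
  if z == x then a
  else if adj x z then (1 - a) / (degree x)%:R
  else 0.

Definition kappa a x y : R :=
  1 - wasserstein (lazy_measure a x) (lazy_measure a y).

Definition kLLY x y : R := lim (kappa a x y / (1 - a) @[a --> 1^'-]).

(* The remainder of this section shows that the limit defining [kLLY] exists
   for every edge, so that [lim] never takes its default value there. *)

Lemma dist_adj u v : adj u v -> (dist u v <= 1)%N.
Proof.
move=> uv; rewrite /dist.
have : (1 < #|G|)%N.
  rewrite (cardD1 u) (cardD1 v) !inE.
  by have -> : v != u by apply: contraTneq uv => ->; rewrite adj_irrefl.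
case: #|G| => [|[|k]] // _ /=.
case: ifP => // _.
suff -> : [exists p : 1.-tuple G, path adj u p && (last u p == v)] by [].
by apply/existsP; exists [tuple v]; rewrite /= uv eqxx.
Qed.

Lemma dist_neq u v : u != v -> (0 < dist u v)%N.
Proof.
move=> uv; rewrite /dist.
have : (0 < #|G|)%N by rewrite (cardD1 u).
case: #|G| => [|k] // _ /=.
case: ifP => // /existsP[p]; rewrite tuple0 /= => /eqP uE.
by rewrite uE eqxx in uv.
Qed.

Lemma sum_lazy_measure a x : (0 < degree x)%N ->
  \sum_z lazy_measure a x z = 1.
Proof.
move=> d0; rewrite (bigD1 x) //= {1}/lazy_measure eqxx.
rewrite (eq_bigr (fun z => if adj x z then (1 - a) / (degree x)%:R else 0));
  last by move=> z /negbTE zx; rewrite /lazy_measure zx.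
rewrite -big_mkcondr /= (eq_bigl (fun z => z \in [set z | adj x z]%SET)); last first.
  by move=> z; rewrite inE; case: eqVneq => [->|] //=; rewrite adj_irrefl.
rewrite sumr_const -/(degree x) -[_ *+ degree x]mulr_natr divfK ?pnatr_eq0 -?lt0n //.
by rewrite addrC subrK.
Qed.

Lemma lazy_measure01 a x z : (0 < degree x)%N -> 0 <= a <= 1 ->
  0 <= lazy_measure a x z <= 1.
Proof.
move=> d0 /andP[a0 a1]; rewrite /lazy_measure.
case: ifP => _; first by rewrite a0.
case: ifP => _; last by rewrite lexx ler01.
rewrite divr_ge0 ?subr_ge0 ?ler0n //=.
rewrite ler_pdivrMr ?ltr0n // mul1r (@le_trans _ _ 1) ?gerBl //.
by rewrite ler1n.
Qed.

Lemma transport_cost_ge0 mu nu pi : coupling mu nu pi -> 0 <= transport_cost pi.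
Proof.
case=> pi01 _ _; apply: sumr_ge0 => u _; apply: sumr_ge0 => v _.
by rewrite mulr_ge0 ?ler0n //; case/andP: (pi01 u v).
Qed.

Lemma has_lbound_transport mu nu :
  has_lbound [set transport_cost pi | pi in coupling mu nu].
Proof. by exists 0 => _ [pi + <-]; exact: transport_cost_ge0. Qed.

Lemma transport_nonempty a x y :
  (0 < degree x)%N -> (0 < degree y)%N -> 0 <= a <= 1 ->
  [set transport_cost pi | pi in
    coupling (lazy_measure a x) (lazy_measure a y)] !=set0.
Proof.
move=> dx dy a01.
pose pi u v := lazy_measure a x u * lazy_measure a y v.
exists (transport_cost pi), pi => //; split.
- move=> u v; have /andP[p0 p1] := lazy_measure01 u dx a01.
  have /andP[q0 q1] := lazy_measure01 v dy a01.
  by rewrite mulr_ge0 //= mulr_ile1.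
- by move=> u; rewrite -mulr_sumr sum_lazy_measure ?mulr1.
- by move=> v; rewrite -mulr_suml sum_lazy_measure ?mul1r.
Qed.

Lemma degree_gt0 x y : adj x y -> (0 < degree x)%N.
Proof. by move=> xy; apply/card_gt0P; exists y; rewrite inE. Qed.

Lemma kappa_le a x y : adj x y -> 0 <= a <= 1 ->
  kappa a x y <= 2 * (1 - a).
Proof.
move=> xy a01; have dx := degree_gt0 xy.
have yx : adj y x by rewrite adj_sym.
have dy := degree_gt0 yx.
suff : 2 * a - 1 <= wasserstein (lazy_measure a x) (lazy_measure a y).
  by rewrite /kappa; lra.
apply: lb_le_inf; first exact: transport_nonempty.
move=> _ [pi [pi01 pix piy] <-].
have pi0 u v : 0 <= pi u v by case/andP: (pi01 u v).
have px : \sum_v pi x v = a by rewrite pix /lazy_measure eqxx.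
have pxx : pi x x <= 1 - a.
  apply: (@le_trans _ _ (lazy_measure a y x)).
    by rewrite -piy (bigD1 x) //= lerDl sumr_ge0.
  have xNy : x == y = false.
    by apply/negbTE; apply: contraTneq xy => ->; rewrite adj_irrefl.
  rewrite /lazy_measure xNy yx ler_pdivrMr ?ltr0n //.
  by rewrite ler_peMr ?ler1n // subr_ge0; case/andP: a01.
apply: (@le_trans _ _ (\sum_(v | v != x) pi x v)).
  by move: px pxx; rewrite (bigD1 x) //=; lra.
rewrite /transport_cost [leRHS](bigD1 x) //= -[leLHS]addr0 lerD //; last first.
  apply: sumr_ge0 => u _; apply: sumr_ge0 => v _.
  by rewrite mulr_ge0 ?ler0n.
rewrite [leRHS](bigD1 x) //= -[leLHS]add0r lerD //.
  by rewrite mulr_ge0 ?ler0n.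
apply: ler_sum => v vx; rewrite ler_peMl // ler1n dist_neq //.
by rewrite eq_sym.
Qed.

Lemma kappa_homo a b x y : adj x y -> 0 <= a -> a <= b -> b < 1 ->
  kappa a x y / (1 - a) <= kappa b x y / (1 - b).
Proof.
move=> xy a0 ab b1; have dx := degree_gt0 xy.
have yx : adj y x by rewrite adj_sym.
have dy := degree_gt0 yx.
have a1 : a < 1 by apply: le_lt_trans b1.
have sa : 0 < 1 - a by rewrite subr_gt0.
have sb : 0 < 1 - b by rewrite subr_gt0.
pose t := (1 - b) / (1 - a).
have t0 : 0 < t by rewrite divr_gt0.
have t1 : t <= 1 by rewrite ler_pdivrMr // mul1r lerD2l lerN2.
have tE : 1 - b = t * (1 - a) by rewrite divfK // gt_eqF.
clearbody t.
have bE : t * a + (1 - t) = b.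
  by move: tE; lra.
suff Wb : wasserstein (lazy_measure b x) (lazy_measure b y) <=
       t * wasserstein (lazy_measure a x) (lazy_measure a y) + (1 - t).
  rewrite ler_pdivrMr // mulrAC ler_pdivlMr // tE mulrA ler_pM2r // mulrC.
  by rewrite /kappa; lra.
rewrite -lerBlDr mulrC -ler_pdivrMr //.
apply: lb_le_inf; first by apply: transport_nonempty => //; rewrite a0 ltW.
move=> _ [pi [pi01 pix piy] <-].
rewrite ler_pdivrMr // mulrC lerBlDr.
pose D (u v : G) : R := ((u == x) && (v == y))%:R.
pose pi' u v := t * pi u v + (1 - t) * D u v.
have s1 : 0 <= 1 - t by rewrite subr_ge0.
have lazyE z w : lazy_measure b z w =
    t * lazy_measure a z w + (1 - t) * (w == z)%:R.
  rewrite /lazy_measure; case: eqP => _; first by rewrite mulr1 bE.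
  by rewrite mulr0 addr0; case: ifP => _; rewrite ?mulr0 // mulrA -tE.
apply: (@le_trans _ _ (transport_cost pi')).
  apply: ge_inf; first exact: has_lbound_transport.
  exists pi' => //; split.
  - move=> u v; have /andP[p0 p1] := pi01 u v.
    have D0 : 0 <= D u v by rewrite /D ler0n.
    have D1 : D u v <= 1 by rewrite /D; case: (_ && _); rewrite ?lexx ?ler01.
    rewrite /pi' addr_ge0 ?mulr_ge0 ?(ltW t0) //=.
    have : t * pi u v <= t by rewrite -[leRHS]mulr1 ler_pM2l.
    have : (1 - t) * D u v <= 1 - t by rewrite -[leRHS]mulr1 ler_wpM2l.
    lra.
  - move=> u; rewrite big_split /= -!mulr_sumr pix lazyE; congr (_ + _ * _).
    rewrite (bigD1 y) //= /D eqxx andbT big1 ?addr0 //.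
    by move=> v /negbTE ->; rewrite andbF.
  - move=> v; rewrite big_split /= -!mulr_sumr piy lazyE; congr (_ + _ * _).
    rewrite (bigD1 x) //= /D eqxx /= big1 ?addr0 //.
    by move=> u /negbTE ->.
rewrite /transport_cost /pi'.
under eq_bigr do under eq_bigr do rewrite mulrDr mulrCA [X in _ + X]mulrCA.
under eq_bigr do rewrite big_split /= -!mulr_sumr.
rewrite big_split /= -!mulr_sumr lerD2l -[leRHS]mulr1 ler_wpM2l //.
rewrite (bigD1 x) //= [X in _ + X]big1 ?addr0; last first.
  by move=> u /negbTE ux; rewrite big1 // => v _; rewrite /D ux mulr0.
rewrite (bigD1 y) //= [X in _ + X]big1 ?addr0; last first.
  by move=> v /negbTE vy; rewrite /D vy andbF mulr0.
by rewrite /D !eqxx mulr1 lern1 dist_adj.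
Qed.

Lemma is_cvg_kLLY x y : adj x y ->
  cvg (kappa a x y / (1 - a) @[a --> 1^'-]).
Proof.
move=> xy; apply: nondecreasing_at_left_is_cvgr.
  near=> c => a b; rewrite !in_itv /= => /andP[ca a1] /andP[cb b1] ab.
  apply: kappa_homo => //; apply: le_trans (ltW ca).
  by near: c; apply: nbhs_left_ge.
near=> c; exists 2 => _ /= [a ca <-]; move: ca; rewrite in_itv /= => /andP[ca a1].
rewrite ler_pdivrMr ?subr_gt0 // kappa_le // (ltW a1) andbT.
apply: le_trans (ltW ca); by near: c; apply: nbhs_left_ge.
Unshelve. all: by end_near. Qed.

End Curvature.

Definition edge_deficit (m n : nat) : nat :=
  if (2 * m <= n)%N then (m - 2 + uphalf n)%N else (n - 1)%N.

(* Main.v *)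
Require Import Defs.
From mathcomp Require Import all_boot all_order all_algebra.
From mathcomp Require Import all_classical all_reals all_analysis.
From mathcomp Require Import zify ring lra.

(* For an edge [xy] with degrees [p] and [q], write [N'x = N(x) \ y] and
   [N'y = N(y) \ x]. A neighbour of [x] is at distance 1 from a neighbour of
   [y] if they are adjacent and at distance 3 otherwise, so the curvature is
   [2 (F - 1 + 1/p + 1/q)] where [F] is the largest flow from [N'x] (supply
   [1/p] each) to [N'y] (demand [1/q] each) along edges. By max-flow min-cut the
   curvature is positive iff [s/p + t/q < 1] whenever no edge joins an [s]-subset
   of [N'x] to a [t]-subset of [N'y]. Such a pair forces at least
   [s t + (n - p) + (m - q)] missing edges, and the minimum of this quantity
   subject to [s/p + t/q >= 1] is [D(m,n)], attained at [t = 1] with [p = n] and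
   [q = 2] or [q = m]. *)

Set Implicit Arguments.
Unset Strict Implicit.
Unset Printing Implicit Defensive.

Import Order.TTheory GRing.Theory Num.Theory.
Import numFieldNormedType.Exports.

(** * Hall's theorem, flows with a deficit, and the arithmetic of the edge deficit *)

Section Combinatorics.
Import fintype boot.finset.
Local Open Scope set_scope.
Local Open Scope nat_scope.

Lemma bigcup_setDr (U V : finType) (S : {set U}) (N : U -> {set V}) (B : {set V}) :
  (\bigcup_(u in S) (N u :\: B) = (\bigcup_(u in S) N u) :\: B)%SET.
Proof.
apply/setP => v; rewrite inE; apply/bigcupP/andP => [[u uS]|[vB /bigcupP[u uS uv]]].
  by rewrite inE => /andP[-> uv]; split=> //; apply/bigcupP; exists u.
by exists u => //; rewrite inE vB.
Qed.

(** Induction on [#|A|] in the manner of Halmos and Vaughan. If a proper nonempty [S] is tight, [S]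
    is matched inside its neighbourhood [NS] and [A :\: S] outside it; otherwise any [a] takes any
    neighbour [b], which is then deleted. *)
Lemma Hall_marriage (U V : finType) (v0 : V) (A : {set U}) (N : U -> {set V}) :
  (forall S : {set U}, S \subset A -> #|S| <= #|(\bigcup_(u in S) N u)%SET|) ->
  exists f : U -> V, {in A, forall u, f u \in N u} /\ {in A &, injective f}.
Proof.
have [k] := ubnP #|A|; elim: k A N => // k IH A N; rewrite ltnS => Ak hallA.
have [->|/set0Pn[a aA]] := eqVneq A set0.
  by exists (fun=> v0); split=> u; rewrite inE.
have [/existsP[S /and4P[SA S0 SnA critS]]|] := boolP [exists S : {set U},
  [&& S \subset A, S != set0, S != A & #|(\bigcup_(u in S) N u)%SET| <= #|S|]].
  pose NS := (\bigcup_(u in S) N u)%SET.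
  have SltA : #|S| < #|A| by apply: proper_card; rewrite properEneq SnA.
  have [||f1 [f1N f1I]] := IH S N; first exact: leq_trans Ak.
    by move=> S' S'S; apply: hallA; apply: subset_trans SA.
  have [||f2 [f2N f2I]] := IH (A :\: S) (fun u => N u :\: NS).
  - by rewrite cardsDS // (leq_trans _ Ak) // ltn_subrL card_gt0 S0 card_gt0 //;
      apply/set0Pn; exists a.
  (* Hall's condition for [S' :|: S] and tightness of [S] leave at least [#|S'|] neighbours outside
     [NS]. *)
  - move=> S'; rewrite subsetD => /andP[S'A dis].
    rewrite bigcup_setDr.
    have: #|S' :|: S| <= #|(\bigcup_(u in S' :|: S) N u)%SET|.
      by apply: hallA; rewrite subUset S'A.
    rewrite bigcup_setU -/NS cardsU (disjoint_setI0 dis) cards0 subn0.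
    have := cardsU (\bigcup_(u in S') N u)%SET NS; rewrite cardsD.
    have := subset_leq_card (subsetIr (\bigcup_(u in S') N u)%SET NS).
    by rewrite /NS in critS *; lia.
  exists (fun u => if u \in S then f1 u else f2 u); split.
    move=> u uA; case: ifPn => [/f1N //|uS].
    by have := f2N u; rewrite !inE uS uA => /(_ isT)/andP[].
  have cross u v : u \in S -> v \notin S -> v \in A -> f1 u <> f2 v.
    move=> uS vS vA uv; have := f2N v; rewrite !inE vS vA -uv => /(_ isT)/andP[/negP[]].
    by apply/bigcupP; exists u => //; apply: f1N.
  move=> u v uA vA; case: ifPn => uS; case: ifPn => vS.
  - exact: f1I.
  - by move/cross => [].
  - by move/esym/cross => [].
  - by apply: f2I; rewrite inE ?uS ?vS.
(* Every proper nonempty subset now has a neighbour to spare, so losing [b] keeps Hall's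
   condition. *)
move/existsPn => noncrit.
have [b bNa] : exists b, b \in N a.
  apply/set0Pn; rewrite -card_gt0; have := hallA [set a].
  by rewrite big_set1 cards1; apply; rewrite sub1set.
have [||f [fN fI]] := IH (A :\ a) (fun u => N u :\ b).
- by move: Ak; rewrite (cardsD1 a) aA.
- move=> S /subsetD1P[SA aS]; rewrite bigcup_setDr.
  have [->|S0] := eqVneq S set0; first by rewrite cards0.
  have /= := noncrit S; rewrite SA S0 /= negb_and negbK -ltnNge.
  case: eqVneq => [SeA|_ /=]; first by rewrite SeA aA in aS.
  by rewrite (cardsD1 b) => lt; lia.
exists (fun u => if u == a then b else f u); split.
  move=> u uA; case: eqVneq => [-> //|ua].
  by have := fN u; rewrite !inE ua uA => /(_ isT)/andP[].
have cross u : u != a -> u \in A -> f u <> b.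
  by move=> ua uA ub; have := fN u; rewrite !inE ua uA ub eqxx => /(_ isT).
move=> u v uA vA; case: eqVneq => [->|ua]; case: eqVneq => [->|va] //.
- by move/esym/cross => [].
- by move/cross => [].
- by apply: fI; rewrite !inE ?ua ?va.
Qed.

(* Hall's theorem for [q] copies of each vertex of [A] against [p] copies of
   each vertex of [B] and [d] dummies adjacent to everything. *)
Lemma deficient_flow (U V : finType) (A : {set U}) (B : {set V})
    (e : U -> V -> bool) (p q d : nat) : 0 < p -> 0 < #|V| ->
  (forall (S : {set U}) (T : {set V}), S \subset A -> T \subset B ->
     (forall u v, u \in S -> v \in T -> ~~ e u v) ->
     #|S| * q + #|T| * p <= #|B| * p + d) ->
  exists f : U -> V -> nat,
    [/\ forall u v, f u v != 0 -> [/\ u \in A, v \in B & e u v],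
        forall u, \sum_v f u v <= q,
        forall v, \sum_u f u v <= p &
        #|A| * q <= \sum_u \sum_v f u v + d].
Proof.
move=> p0 /card_gt0P[v0 _] nocut.
pose N (w : U * 'I_q) : {set V * 'I_p + 'I_d} :=
  [set z | if z is inl z' then (z'.1 \in B) && e w.1 z'.1 else true].
have [|g [gN gI]] := @Hall_marriage _ _ (inl (v0, Ordinal p0)) (setX A setT) N.
  move=> S SA; pose S1 := fst @: S.
  (* [S1] and [T] form a cut, and the neighbourhood of a nonempty [S] consists of all copies of
     [B :\: T] and all dummies; the hypothesis on cuts then is Hall's condition. *)
  pose T := [set v in B | [forall u in S1, ~~ e u v]].
  have [->|/set0Pn[w0 w0S]] := eqVneq S set0; first by rewrite cards0.
  have S1q : #|S| <= #|S1| * q.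
    rewrite -[q in _ * q]card_ord -cardsT -cardsX; apply: subset_leq_card.
    by apply/subsetP => -[u i] uiS; rewrite !inE andbT; apply/imsetP; exists (u, i).
  have := nocut S1 T.
  have -> : S1 \subset A.
    apply/subsetP => _ /imsetP[[u i] uiS ->].
    by have /subsetP/(_ _ uiS) := SA; rewrite !inE andbT.
  have -> : T \subset B by apply/subsetP => v; rewrite inE => /andP[].
  have noe u v : u \in S1 -> v \in T -> ~~ e u v.
    by move=> uS; rewrite inE => /andP[_ /forall_inP]; apply.
  move=> /(_ isT isT noe) cut.
  have NE : (\bigcup_(w in S) N w)%SET =
      (inl @: setX (B :\: T) [set: 'I_p]) :|: (inr @: [set: 'I_d]).
    apply/setP => -[[v j]|j].
      rewrite in_setU mem_imset; last by move=> ? ? [].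
      rewrite !inE andbT [X in _ || X](_ : _ = false) ?orbF; last first.
        by apply/negbTE/imsetP => -[].
      apply/bigcupP/andP => [[[u i] uiS]|[]].
        rewrite inE /= => /andP[vB uv]; split => //.
        rewrite vB /=; apply/negP => /forall_inP/(_ u); rewrite uv => /(_ _)/negP[] //.
        by apply/imsetP; exists (u, i).
      rewrite negb_and => /[swap] vB; rewrite vB /= => /forall_inPn[u].
      move=> /imsetP[w wS ->] /negbNE wv; exists w => //.
      by rewrite inE /= vB.
    rewrite in_setU [in RHS]orbC mem_imset ?inE /=; last by move=> ? ? [].
    by apply/bigcupP; exists w0 => //; rewrite inE.
  rewrite NE cardsU (_ : _ :&: _ = set0) ?cards0 ?subn0; last first.
    by apply/setP => z; rewrite !inE; apply/negP => /andP[/imsetP[? _ ->] /imsetP[]].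
  rewrite !card_imset; try by move=> ? ? [].
  rewrite cardsX !cardsT !card_ord cardsDS; last first.
    by apply/subsetP => v; rewrite inE => /andP[].
  have TB : #|T| <= #|B| by apply: subset_leq_card; apply/subsetP => v; rewrite inE => /andP[].
  by rewrite mulnBl; lia.
(* [f u v] counts the copies of [u] matched to copies of [v]. The copies matched to dummies, at most
   [d] of them, account for the loss in the total. *)
pose h w v : bool := (w.1 \in A) && (if g w is inl z then z.1 == v else false).
pose f u v := \sum_(i < q) h (u, i) v.
exists f; split.
- move=> u v; rewrite sum_nat_eq0 => /forallPn[i /=]; rewrite eqb0 negbK /h /=.
  case/andP=> uA; have := gN (u, i); rewrite !inE uA => /(_ isT) /=.
  by case: (g _) => //= -[v' j] /= /andP[v'B e1] /eqP <-.
- move=> u; rewrite exchange_big /= -[leqRHS](card_ord q) -sum1_card.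
  apply: leq_sum => i _; rewrite /h /=; case: (u \in A) => /=; last by rewrite big1.
  case: (g _) => [[v j]|j] /=; last by rewrite big1.
  by rewrite (bigD1 v) //= eqxx big1 // => v' /negbTE; rewrite eq_sym => ->.
- move=> v; rewrite pair_big /= (eq_bigr (fun w => h w v : nat)) => [|[] //].
  rewrite -big_mkcond sum1dep_card -[leqRHS](card_ord p) -cardsT.
  rewrite -(card_imset _ (_ : injective (fun j : 'I_p => inl (v, j) : V * 'I_p + 'I_d)));
    last by move=> ? ? [].
  rewrite -(@card_in_imset _ _ g) => [|w w']; last first.
    by rewrite !inE => /andP[wA _] /andP[w'A _]; apply: gI; rewrite !inE ?wA ?w'A.
  apply: subset_leq_card; apply/subsetP => _ /imsetP[w + ->].
  rewrite inE => /andP[_]; case: (g w) => // -[v' j] /= /eqP ->.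
  by apply/imsetP; exists j.
- have -> : \sum_u \sum_v f u v =
      #|[set w in setX A [set: 'I_q] | if g w is inl _ then true else false]|.
    rewrite -sum1dep_card [RHS]big_mkcond /=.
    under eq_bigr do rewrite exchange_big /=.
    rewrite pair_big /=; apply: eq_bigr => -[u i] _ /=; rewrite !inE andbT.
    rewrite /h /=; case: (u \in A) => /=; last by rewrite big1.
    case: (g _) => [[v j]|j] /=; last by rewrite big1.
    by rewrite (bigD1 v) //= eqxx big1 // => v' /negbTE; rewrite eq_sym => ->.
  have inr_le : #|[set w in setX A [set: 'I_q] | if g w is inl _ then false else true]| <= d.
    rewrite -[leqRHS](card_ord d) -cardsT.
    rewrite -(card_imset _ (_ : injective (fun j => inr j : V * 'I_p + 'I_d)));
      last by move=> ? ? [].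
    rewrite -(@card_in_imset _ _ g) => [|w w']; last first.
      by rewrite !inE => /andP[wA _] /andP[w'A _]; apply: gI; rewrite !inE.
    apply: subset_leq_card; apply/subsetP => _ /imsetP[w + ->].
    by rewrite inE => /andP[_]; case: (g w) => // j _; apply/imsetP; exists j.
  rewrite -[q in leqLHS]card_ord -cardsT -cardsX.
  rewrite -(cardsID [set w | if g w is inl _ then true else false]) leq_add //.
    by rewrite setIdE.
  apply: leq_trans inr_le; apply: subset_leq_card; apply/subsetP => w.
  by rewrite !inE; case: (g w) => ? /=; rewrite ?andbT.
Qed.

(* With [P = p - s] and [Q = q - t] the hypothesis reads [P Q <= s t], and the
   claim [P + Q <= K + (s - 1) (t - 1)] for [K] as below. *)
Lemma edge_deficit_le (m n p q s t : nat) : p <= n -> q <= m -> s < p -> t < q ->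
  p * q <= s * q + t * p ->
  edge_deficit m n <= s * t + (n - p) + (m - q).
Proof.
move=> pn qm sp tq le.
have [P pE] : exists P, p = s + P by exists (p - s); lia.
have [Q qE] : exists Q, q = t + Q by exists (q - t); lia.
subst p q.
have PQ : P * Q <= s * t by nia.
have s0 : 0 < s by nia.
have t0 : 0 < t by nia.
(* [K] unifies the two cases of the deficit: it is [1 + n./2] when [2 * m <= n], and [m]
   otherwise. *)
have [K [Km Kn ->]] : exists K, [/\ m <= K, n < 2 * K & edge_deficit m n = n + m - 1 - K].
  rewrite /edge_deficit; case: ifP => h; first by exists (1 + n./2); split; lia.
  by exists m; split; lia.
suff: P + Q + s + t <= K + s * t + 1 by lia.
have [P1|P2] := leqP P 1; first by nia.
have [Q1|Q2] := leqP Q 1.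
  have ->: Q = 1 by lia.
  have [t1|t2] := leqP t 1; first by nia.
  have [stK|stK] := leqP (s + t) K; first by nia.
  have [s1|s2] := leqP s 1; first by nia.
  (* Here [s + t > K] and [s, t >= 2]; by [s + P <= n < 2 K] what remains is
     [(s - 2) (t - 1) >= 0]. *)
  nia.
(* For [t = 1], [P (Q + 1) <= s + P < 2 K] and [(P - 2) (Q - 1) >= 0] give [2 (P + Q) <= 2 K + 1],
   hence [P + Q <= K] by parity. *)
have [t1|t2] := leqP t 1; first by nia.
have [s1|s2] := leqP s 1; first by nia.
(* All four numbers are at least 2, so [P + Q] and [s + t] are each at most [s t / 2 + 2], and
   [K >= t + Q >= 4]. *)
nia.
Qed.

End Combinatorics.

(** * Graph distance and the edges of a bipartite graph *)

Section Graph.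
Import fintype boot.finset.
Local Open Scope set_scope.
Local Open Scope nat_scope.
Variable G : sgraph.
Implicit Types (u v : G) (p : seq G).

Lemma dist_le_walk u p : path adj u p -> dist u (last u p) <= size p.
Proof.
move=> up; rewrite /dist leqNgt; apply/negP => lt_find.
have := before_find 0 lt_find; rewrite nth_iota ?add0n; last first.
  by apply: leq_trans lt_find _; rewrite -{2}(size_iota 0 #|G|) find_size.
by move/existsP => []; exists (in_tuple p); rewrite /= up eqxx.
Qed.

Lemma distxx u : dist u u = 0.
Proof. by apply/eqP; rewrite -leqn0 (@dist_le_walk u [::]). Qed.

Lemma dist_common_neighbor u v w : adj u v -> adj v w -> dist u w <= 2.
Proof. by move=> uv vw; apply: (@dist_le_walk u [:: v; w]); rewrite /= uv vw. Qed.

(* The bound on [#|G|] covers the value [dist u v = #|G|] taken when [v] is not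
   reachable from [u]. *)
Lemma lipschitz_dist (phi : G -> nat) u v : phi u <= phi v + #|G| ->
  (forall a b, adj a b -> phi a <= phi b + 1) -> phi u <= phi v + dist u v.
Proof.
move=> phiG phi1.
have phi_walk s w : path adj w s -> phi w <= phi (last w s) + size s.
  elim: s w => /= [w _|z s IH w /andP[/phi1 wz /IH]]; first by rewrite addn0.
  by lia.
rewrite /dist; set P := (X in find X _).
have [|hasN] := boolP (has P (iota 0 #|G|)); last first.
  by rewrite (hasNfind hasN) size_iota.
move=> hasP; have := nth_find 0 hasP; rewrite has_find size_iota in hasP.
rewrite nth_iota // add0n => /existsP[s /andP[us /eqP <-]].
by have := phi_walk _ _ us; rewrite size_tuple.
Qed.

Lemma bipartitionC (X Y : {set G}) : bipartition X Y -> bipartition Y X.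
Proof.
case=> XY dis E; split; [by rewrite setUC|by rewrite disjoint_sym|].
by move=> u v /E[]; [right|left].
Qed.

Lemma nbr_sub (X Y : {set G}) x : bipartition X Y -> x \in X ->
  [set z | adj x z] \subset Y.
Proof.
case=> _ dis E xX; apply/subsetP => z; rewrite inE => /E[[]|[xY _]] //.
by have := disjointFl dis xY; rewrite xX.
Qed.

(** Each edge has exactly one orientation from [X] to [Y], so unordered edges can be counted as
    ordered pairs. *)
Lemma card_edges_bipartition (X Y : {set G}) : bipartition X Y ->
  #|edges G| = #|[set p in setX X Y | adj p.1 p.2]|.
Proof.
case=> XY dis E; have disXY u : u \in X -> u \notin Y by move=> uX; rewrite (disjointFr dis uX).
rewrite /edges (_ : [set [set p.1; p.2] | p in _]%SET =
  [set [set p.1; p.2] | p in [set p in setX X Y | adj p.1 p.2]]%SET); last first.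
  apply/setP => A; apply/imsetP/imsetP => [[[u v]]|[[u v]]]; rewrite !inE /=.
    move=> uv ->; have [[uX vY]|[uY vX]] := E _ _ uv.
      by exists (u, v); rewrite ?inE /= ?uX ?vY.
    by exists (v, u); rewrite ?inE /= ?uY ?vX 1?adj_sym 1?setUC.
  by case/andP=> _ uv ->; exists (u, v); rewrite ?inE.
rewrite card_in_imset // => -[u v] [u' v']; rewrite !inE /=.
move=> /andP[/andP[uX vY] _] /andP[/andP[u'X v'Y] _] e.
have := set21 u v; rewrite e !inE => /orP[/eqP uu|/eqP uv]; last first.
  by have := disXY _ uX; rewrite uv v'Y.
have := set22 u v; rewrite e !inE => /orP[/eqP vu|/eqP vv]; last first.
  by rewrite uu vv.
by have := disXY _ u'X; rewrite -vu vY.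
Qed.

End Graph.

(** * Sign of the curvature from flows and cuts *)

Section Curvature.
Import fintype boot.finset.
Local Open Scope set_scope.
Local Open Scope ring_scope.
Variables (R : realType) (G : sgraph) (X Y : {set G}).
Hypothesis XY : bipartition X Y.
Implicit Types (x y u v : G).

(** The quotient [kappa a x y / (1 - a)] is nondecreasing in [a], so a positive value at a single
    [a] bounds the limit from below. *)
Lemma kLLY_gt0 x y a : adj x y -> 0 <= a < 1 ->
  wasserstein (lazy_measure (a : R) x) (lazy_measure a y) < 1 -> 0 < kLLY R x y.
Proof.
move=> xy /andP[a0 a1] W1; apply: (@lt_le_trans _ _ (kappa a x y / (1 - a))).
  by rewrite divr_gt0 ?subr_gt0.
apply: limr_ge; first exact: is_cvg_kLLY.
near=> b; apply: kappa_homo => //; first by near: b; apply: nbhs_left_ge.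
Unshelve. all: by end_near. Qed.

(** Only [a] near 1 enters the limit, so a bound on [[1/2, 1)] suffices. *)
Lemma kLLY_le0 x y : adj x y ->
  (forall a : R, 1 / 2 <= a < 1 -> 1 <= wasserstein (lazy_measure (a : R) x) (lazy_measure a y)) ->
  kLLY R x y <= 0.
Proof.
move=> xy W1; apply: limr_le; first exact: is_cvg_kLLY.
near=> b; have b1 : b < 1 by [].
rewrite mulr_le0_ge0 ?invr_ge0 ?subr_ge0 ?(ltW b1) // subr_le0 W1 // b1 andbT.
by near: b; apply: nbhs_left_ge; lra.
Unshelve. all: by end_near. Qed.

Local Notation pnbr x y := ([set z | adj x z] :\ y).

(** * The transport plan built from a flow, at laziness 1/2 *)

Section FlowCoupling.
Variables (x y : G) (f : G -> G -> R).
Hypotheses (xy : adj x y) (f0 : forall u v, 0 <= f u v).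
Hypothesis fsupp : forall u v, f u v != 0 ->
  [/\ u \in pnbr x y, v \in pnbr y x & adj u v].
Hypothesis frow : forall u, \sum_v f u v <= (degree x)%:R^-1.
Hypothesis fcol : forall v, \sum_u f u v <= (degree y)%:R^-1.

Let p : R := (degree x)%:R^-1.
Let q : R := (degree y)%:R^-1.
Let F := \sum_u \sum_v f u v.
Let row u := \sum_v f u v.
Let col v := \sum_u f u v.

(* The flow [f], halved, moves the neighbours of [x] onto those of [y]; what it
   leaves over is routed through [y] and [x], at distance 2. *)
Let pi u v : R := (f u v
  + (v == y)%:R * ((u \in pnbr x y)%:R * (p - row u))
  + (u == x)%:R * ((v \in pnbr y x)%:R * (q - col v))
  + (v == x)%:R * ((u == x)%:R * q) + (v == y)%:R * ((u == y)%:R * p)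
  + (v == y)%:R * ((u == x)%:R * F)) / 2.

Let sum_eq (z : G) (h : G -> R) : \sum_v (v == z)%:R * h v = h z.
Proof. by rewrite (bigD1 z) //= eqxx mul1r big1 ?addr0 // => v /negbTE->; rewrite mul0r. Qed.

Let rowE u : (u \in pnbr x y)%:R * row u = row u.
Proof.
have [h|h] := boolP (_ \in _); rewrite ?mul1r // mul0r /row big1 // => v _.
by apply/eqP; apply: contraNT h => /fsupp[].
Qed.

Let colE v : (v \in pnbr y x)%:R * col v = col v.
Proof.
have [h|h] := boolP (_ \in _); rewrite ?mul1r // mul0r /col big1 // => u _.
by apply/eqP; apply: contraNT h => /fsupp[].
Qed.

Let yx : adj y x. Proof. by rewrite adj_sym. Qed.

Let card_pnbr (a b : G) : adj a b -> \sum_v (v \in pnbr a b)%:R = (degree a)%:R - 1 :> R.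
Proof.
move=> ab; rewrite -natr_sum /degree [in RHS](cardsD1 b) inE ab natrD [RHS]addrC addKr.
by congr _%:R; rewrite -sum1_card [RHS]big_mkcond; apply: eq_bigr => v _; case: (v \in _).
Qed.

Let sum_rest (a b : G) (c : R) (h : G -> R) : adj a b -> c = (degree a)%:R^-1 ->
  (forall v, (v \in pnbr a b)%:R * h v = h v) ->
  \sum_v (v \in pnbr a b)%:R * (c - h v) = 1 - c - \sum_v h v.
Proof.
move=> ab -> hE; under eq_bigr do rewrite mulrBr hE.
rewrite big_split /= -mulr_suml card_pnbr // mulrBl mul1r divff ?sumrN //.
by rewrite pnatr_eq0 -lt0n (degree_gt0 ab).
Qed.

Let colF : \sum_v col v = F. Proof. by rewrite /col exchange_big. Qed.

Let F_ge0 : 0 <= F.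
Proof. by rewrite /F; do 2 (apply: sumr_ge0 => ? _). Qed.

Let pi_ge0 u v : 0 <= pi u v.
Proof.
have p0 : 0 <= p by rewrite invr_ge0.
have q0 : 0 <= q by rewrite invr_ge0.
rewrite /pi divr_ge0 // !addr_ge0 // !mulr_ge0 ?ler0n ?subr_ge0 //.
  exact: frow.
exact: fcol.
Qed.

Let lazyE (a b z : G) : adj a b -> lazy_measure (1 / 2) a z =
  ((z == a)%:R + ((z \in pnbr a b)%:R + (z == b)%:R) * (degree a)%:R^-1) / 2 :> R.
Proof.
move=> ab; rewrite /lazy_measure !inE; case: eqVneq => [->|za].
  rewrite adj_irrefl andbF; case: eqVneq ab => [->|_ _]; first by rewrite adj_irrefl.
  by rewrite addr0 mul0r addr0.
rewrite add0r; case: eqVneq => [->|zb] /=.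
  by rewrite ab add0r mul1r; lra.
by case: (adj a z); rewrite addr0 ?mul0r ?mul1r; lra.
Qed.

Let pi_row u : \sum_v pi u v = lazy_measure (1 / 2) x u.
Proof.
rewrite -mulr_suml !big_split /= !sum_eq -mulr_sumr (sum_rest yx erefl colE) colF.
rewrite (lazyE _ xy) -/(row u) mulrBr rowE -/p -/q.
set i := (u == x)%:R; set j := (u == y)%:R; set k := (u \in _)%:R; nra.
Qed.

Let pi_col v : \sum_u pi u v = lazy_measure (1 / 2) y v.
Proof.
rewrite -mulr_suml !big_split /= -!mulr_sumr !sum_eq (sum_rest xy erefl rowE) -/F.
rewrite (lazyE _ yx) -/(col v) [(v \in _)%:R * (_ - _)]mulrBr colE -/p -/q.
set i := (v == x)%:R; set j := (v == y)%:R; set k := (v \in _)%:R; nra.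
Qed.

Let flow_coupling : coupling (lazy_measure (1 / 2) x) (lazy_measure (1 / 2) y) pi.
Proof.
split => // u v; rewrite pi_ge0 /=.
have half01 : 0 <= (1 / 2 : R) <= 1 by lra.
have /andP[_] := lazy_measure01 u (degree_gt0 xy) half01.
by apply: le_trans; rewrite -pi_row (bigD1 v) //= lerDl sumr_ge0.
Qed.

(** In [pi] the flow moves mass [F / 2] at distance 1, the leftovers [(1 - p - F) / 2] and
    [(1 - q - F) / 2] travel distance at most 2, and the mass [F / 2] sent from [x] to [y] balances
    the marginals at distance 1. *)
Lemma wasserstein_flow_le :
  wasserstein (lazy_measure (1 / 2) x) (lazy_measure (1 / 2) y) <= 2 - p - q - F.
Proof.
apply: (@le_trans _ _ (transport_cost pi)).
  by apply: ge_inf; [exact: has_lbound_transport|exists pi].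
(* [c] is [pi] with each term weighted by a bound on its distance: 1, 2, 2, 0, 0, 1 in order. *)
pose c u v : R := (f u v
  + (v == y)%:R * (2 * ((u \in pnbr x y)%:R * (p - row u)))
  + (u == x)%:R * (2 * ((v \in pnbr y x)%:R * (q - col v)))
  + (v == y)%:R * ((u == x)%:R * F)) / 2.
apply: (@le_trans _ _ (\sum_u \sum_v c u v)); last first.
  under eq_bigr do rewrite -mulr_suml !big_split /= !sum_eq -!mulr_sumr.
  rewrite -mulr_suml !big_split /= -!mulr_sumr.
  rewrite (sum_rest xy erefl rowE) !sum_eq (sum_rest yx erefl colE) colF -/F -/p -/q.
  lra.
apply: ler_sum => u _; apply: ler_sum => v _.
rewrite /pi /c mulrA ler_pM2r ?invr_gt0 // !mulrDr.
have f_le : (dist u v)%:R * f u v <= f u v.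
  have [->|/fsupp[_ _ uv]] := eqVneq (f u v) 0; first by rewrite mulr0.
  by rewrite ler_piMl // lern1 dist_adj.
have to_y_le : (dist u v)%:R * ((v == y)%:R * ((u \in pnbr x y)%:R * (p - row u)))
    <= (v == y)%:R * (2 * ((u \in pnbr x y)%:R * (p - row u))).
  have [->|_] := eqVneq v y; last by rewrite !mul0r mulr0.
  have [|_] := boolP (u \in _); last by rewrite !mul0r !mulr0.
  rewrite !inE => /andP[_ xu]; rewrite !mul1r ler_wpM2r ?subr_ge0 ?frow // ler_nat.
  by apply: dist_common_neighbor xy; rewrite adj_sym.
have from_x_le : (dist u v)%:R * ((u == x)%:R * ((v \in pnbr y x)%:R * (q - col v)))
    <= (u == x)%:R * (2 * ((v \in pnbr y x)%:R * (q - col v))).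
  have [->|_] := eqVneq u x; last by rewrite !mul0r mulr0.
  have [|_] := boolP (v \in _); last by rewrite !mul0r !mulr0.
  rewrite !inE => /andP[_ yv]; rewrite !mul1r ler_wpM2r ?subr_ge0 ?fcol // ler_nat.
  exact: dist_common_neighbor yv.
have stay (z : G) (r : R) : (dist u v)%:R * ((v == z)%:R * ((u == z)%:R * r)) = 0.
  have [->|_] := eqVneq v z; last by rewrite mul0r mulr0.
  by have [->|_] := eqVneq u z; rewrite ?distxx ?mul0r ?mulr0.
have xy_le : (dist u v)%:R * ((v == y)%:R * ((u == x)%:R * F))
    <= (v == y)%:R * ((u == x)%:R * F).
  have [->|_] := eqVneq v y; last by rewrite !mul0r mulr0.
  have [->|_] := eqVneq u x; last by rewrite !mul0r !mulr0.
  by rewrite !mul1r ler_piMl // lern1 dist_adj.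
by rewrite !stay; lra.
Qed.

End FlowCoupling.

(** An integral flow is scaled by [c], the inverse of the product of the degrees. Integrality turns
    the strict inequality into a margin of one unit, so the Wasserstein distance is at most
    [1 - c]. *)
Lemma kLLY_gt0_of_no_cut x y : adj x y ->
  (forall S T : {set G}, S \subset pnbr x y -> T \subset pnbr y x ->
     (forall u v, u \in S -> v \in T -> ~~ adj u v) ->
     (#|S| * degree y + #|T| * degree x < degree x * degree y)%N) ->
  0 < kLLY R x y.
Proof.
move=> xy nocut; have yx : adj y x by rewrite adj_sym.
have dx := degree_gt0 xy; have dy := degree_gt0 yx.
have card_pnbr a b : adj a b -> #|pnbr a b| = (degree a - 1)%N.
  by move=> ab; rewrite /degree [in RHS](cardsD1 b) inE ab add1n subn1.
(* With [degree x - 1] dummies the right side of the cut condition is [degree x * degree y - 1],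
   which is the strict bound of [nocut]. *)
have [| |S T SA TB noST|f [fsupp frow fcol fsum]] :=
  @deficient_flow _ _ (pnbr x y) (pnbr y x) adj (degree x) (degree y) (degree x - 1).
- by [].
- by apply/card_gt0P; exists x.
- by have := nocut S T SA TB noST; rewrite card_pnbr // mulnBl mul1n mulnC; nia.
pose c : R := ((degree x)%:R * (degree y)%:R)^-1.
have dx0 : (0 : R) < (degree x)%:R by rewrite ltr0n.
have dy0 : (0 : R) < (degree y)%:R by rewrite ltr0n.
have c0 : 0 < c by rewrite invr_gt0 mulr_gt0.
have cx : (degree y)%:R * c = (degree x)%:R^-1 by rewrite /c; field; lra.
have cy : (degree x)%:R * c = (degree y)%:R^-1 by rewrite /c; field; lra.
apply: (@kLLY_gt0 _ _ (1 / 2)) => //; first by lra.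
apply: (le_lt_trans (@wasserstein_flow_le _ _ (fun u v => (f u v)%:R * c) xy _ _ _ _)).
- by move=> u v; rewrite mulr_ge0 // ltW.
- by move=> u v fc; apply: fsupp; apply: contraNneq fc => ->; rewrite mul0r.
- by move=> u; rewrite -mulr_suml -natr_sum -cx ler_pM2r // ler_nat.
- by move=> v; rewrite -mulr_suml -natr_sum -cy ler_pM2r // ler_nat.
under eq_bigr do rewrite -mulr_suml -natr_sum.
rewrite -mulr_suml -natr_sum -cx -cy.
have : c * ((degree x)%:R * (degree y)%:R) = 1 by rewrite /c mulVf // mulf_neq0 ?gt_eqF.
have : (degree x * degree y + 1 <= \sum_u \sum_v f u v + degree x + degree y)%N.
  by move: fsum; rewrite card_pnbr // mulnBl mul1n; nia.
rewrite -(ler_nat R) !natrD natrM -(ler_pM2r c0).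
by move=> + ?; nra.
Qed.

(* Kantorovich duality with the potential [phi], which is 1-Lipschitz because
   no edge joins [S] to [T]. *)
Lemma kLLY_le0_of_cut x y (S T : {set G}) : x \in X -> adj x y ->
  S \subset pnbr x y -> T \subset pnbr y x ->
  (forall u v, u \in S -> v \in T -> ~~ adj u v) ->
  (degree x * degree y <= #|S| * degree y + #|T| * degree x)%N ->
  (3 < #|G|)%N -> kLLY R x y <= 0.
Proof.
move=> xX xy SA TB noST cut G3; have yx : adj y x by rewrite adj_sym.
have [XYT dis E] := XY.
have dx := degree_gt0 xy; have dy := degree_gt0 yx.
apply: kLLY_le0 => // a /andP[a2 a1].
apply: lb_le_inf.
  by apply: transport_nonempty => //; lra.
move=> _ [pi [pi01 pix piy] <-].
(* [phi] is 2 on [X], lowered to 0 on [T], and 1 on [Y], raised to 3 on [S]. Along an edge it could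
   change by more than 1 only between [S] and [T]. *)
pose phi z : nat := if z \in X then (2 - 2 * (z \in T))%N else (1 + 2 * (z \in S))%N.
have phi_lip u v : (phi u)%:R - (phi v)%:R <= (dist u v)%:R :> R.
  rewrite lerBlDl -natrD ler_nat; apply: lipschitz_dist.
    (* Since [phi] is at most 3, the size of [G] covers the default distance between different
       components. *)
    apply: leq_trans (leq_addl _ _); apply: leq_trans (ltnW G3).
    by rewrite /phi; case: (u \in X); case: (u \in T); case: (u \in S).
  move=> b d bd; rewrite /phi.
  have [[bX dY]|[bY dX]] := E _ _ bd.
    by rewrite bX (disjointFl dis dY); case: (b \in T); case: (d \in S).
  rewrite dX (disjointFl dis bY).
  have [bS|] := boolP (b \in S); last by case: (d \in T).
  have [dT|] := boolP (d \in T); last by [].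
  by have := noST _ _ bS dT; rewrite bd.
have sum_lazy (h : G -> R) z : \sum_u h u * lazy_measure a z u =
    a * h z + (1 - a) / (degree z)%:R * \sum_(u in [set w | adj z w]) h u.
  rewrite (bigD1 z) //= {1}/lazy_measure eqxx mulrC; congr (_ + _).
  rewrite mulr_sumr [RHS]big_mkcond [LHS]big_mkcond; apply: eq_bigr => u _.
  rewrite inE /lazy_measure; case: eqVneq => [->|_] /=; first by rewrite adj_irrefl.
  by case: ifP => _; rewrite ?mulr0 // mulrC.
have sum_in (A B : {set G}) : A \subset B -> \sum_(u in B) (u \in A)%:R = #|A|%:R :> R.
  move=> AB; rewrite -natr_sum -sum1_card; congr _%:R.
  rewrite big_mkcond [RHS]big_mkcond; apply: eq_bigr => u _.
  by case: (boolP (u \in A)) => [/(subsetP AB) ->|] //; case: ifP.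
have SN : S \subset [set w | adj x w] by apply: subset_trans SA (subD1set _ _).
have TN : T \subset [set w | adj y w] by apply: subset_trans TB (subD1set _ _).
have phix : \sum_u (phi u)%:R * lazy_measure a x u =
    a * 2 + (1 - a) / (degree x)%:R * ((degree x)%:R + 2 * #|S|%:R).
  rewrite sum_lazy /phi xX (_ : x \in T = false); last first.
    by apply: contraTF TB => xT; apply/subsetPn; exists x; rewrite // !inE eqxx.
  congr (_ + _ * _); rewrite -(sum_in _ _ SN) /degree -sum1_card natr_sum mulr_sumr -big_split.
  apply: eq_bigr => u; rewrite inE => xu; have [[_ uY]|[xY _]] := E _ _ xu.
    by rewrite (disjointFl dis uY) natrD natrM.
  by have := disjointFl dis xY; rewrite xX.
have phiy : \sum_v (phi v)%:R * lazy_measure a y v =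
    a + (1 - a) / (degree y)%:R * (2 * (degree y)%:R - 2 * #|T|%:R).
  have yY : y \in Y.
    by have [[]|[xY _]] := E _ _ xy; first by []; have := disjointFl dis xY; rewrite xX.
  rewrite sum_lazy /phi (disjointFl dis yY) (_ : y \in S = false); last first.
    by apply: contraTF SA => yS; apply/subsetPn; exists y; rewrite // !inE eqxx.
  rewrite mulr1; congr (_ + _ * _).
  rewrite -(sum_in _ _ TN) /degree -sum1_card natr_sum !mulr_sumr -sumrB.
  apply: eq_bigr => u; rewrite inE => yu; have [[yX _]|[_ uX]] := E _ _ yu.
    by rewrite (disjointFl dis yY) in yX.
  by rewrite uX; case: (u \in T); rewrite /= ?mulr0 ?subr0 ?mulr1 ?subrr.
(* With [s'] and [t'] the fractions of [S] and [T] in the degrees, the difference of the integrals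
   is [a + (1 - a) (2 s' + 2 t' - 1)], at least 1 because [s' + t' >= 1]. *)
apply: (@le_trans _ _ (\sum_u (phi u)%:R * lazy_measure a x u
    - \sum_v (phi v)%:R * lazy_measure a y v)).
  have dx0 : (0 : R) < (degree x)%:R by rewrite ltr0n.
  have dy0 : (0 : R) < (degree y)%:R by rewrite ltr0n.
  have cutR : 1 <= #|S|%:R / (degree x)%:R + #|T|%:R / (degree y)%:R :> R.
    by rewrite addf_div ?gt_eqF // ler_pdivlMr ?mulr_gt0 // mul1r -!natrM -natrD ler_nat.
  have {}phix : \sum_u (phi u)%:R * lazy_measure a x u =
      a * 2 + (1 - a) * (1 + 2 * (#|S|%:R / (degree x)%:R)).
    by rewrite phix; field; rewrite gt_eqF.
  have {}phiy : \sum_v (phi v)%:R * lazy_measure a y v =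
      a + (1 - a) * (2 - 2 * (#|T|%:R / (degree y)%:R)).
    by rewrite phiy; field; rewrite gt_eqF.
  by rewrite phix phiy; move: cutR; set s' := _ / _; set t' := _ / _ => cutR; nra.
rewrite (eq_bigr (fun u => \sum_v (phi u)%:R * pi u v)); last first.
  by move=> u _; rewrite -mulr_sumr pix.
rewrite [X in _ - X](eq_bigr (fun v => \sum_u (phi v)%:R * pi u v)); last first.
  by move=> v _; rewrite -mulr_sumr piy.
rewrite [X in _ - X]exchange_big -sumrB; apply: ler_sum => u _.
rewrite -sumrB; apply: ler_sum => v _; rewrite -mulrBl ler_wpM2r //.
by case/andP: (pi01 u v).
Qed.

End Curvature.

(** * Missing edges forced by a cut *)

Section EdgeCount.
Import fintype boot.finset.
Local Open Scope set_scope.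
Local Open Scope nat_scope.
Variables (G : sgraph) (X Y : {set G}).
Hypothesis XY : bipartition X Y.

Lemma card_missing_edges :
  #|edges G| + #|[set p in setX X Y | ~~ adj p.1 p.2]| = #|X| * #|Y|.
Proof.
rewrite (card_edges_bipartition XY) -cardsX -(cardsID [set p : G * G | adj p.1 p.2] (setX X Y)).
by congr addn; apply: eq_card => p; rewrite !inE // andbC.
Qed.

(** Three families of missing edges are counted: between [T] and [S], at [x], and at [y]. They are
    pairwise disjoint because [x] is not in [T], [y] is not in [S], and [x], [y] are adjacent. *)
Lemma card_edges_cut x y (S T : {set G}) : x \in X -> adj x y ->
  S \subset [set z | adj x z] :\ y -> T \subset [set z | adj y z] :\ x ->
  (forall u v, u \in S -> v \in T -> ~~ adj u v) ->
  #|edges G| + (#|S| * #|T| + (#|Y| - degree x) + (#|X| - degree y)) <= #|X| * #|Y|.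
Proof.
move=> xX xy /subsetP SA /subsetP TB noST.
have yY : y \in Y by apply: (subsetP (nbr_sub XY xX)); rewrite inE.
have SY u : u \in S -> u \in Y.
  by move/SA; rewrite in_setD1 => /andP[_]; apply: subsetP (nbr_sub XY xX) u.
have NyX := nbr_sub (bipartitionC XY) yY.
have TX u : u \in T -> u \in X.
  by move/TB; rewrite in_setD1 => /andP[_]; apply: subsetP NyX u.
rewrite -card_missing_edges leq_add2l.
pose M2 := setX [set x] (Y :\: [set z | adj x z]).
pose M3 := setX (X :\: [set z | adj y z]) [set y].
have disj12 : setX T S :&: M2 = set0.
  apply/setP => -[u v]; rewrite !inE /=; apply/negP => /andP[/andP[uT vS]].
  by case/andP=> /eqP ux; have := TB _ uT; rewrite ux !inE eqxx.
have disj3 : (setX T S :|: M2) :&: M3 = set0.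
  apply/setP => -[u v]; rewrite !inE /=; apply/negP => /andP[/orP[/andP[uT vS]|]].
    by case/andP=> _ /eqP vy; have := SA _ vS; rewrite vy !inE eqxx.
  by case/andP=> /eqP -> /andP[xv _] /andP[_ /eqP vy]; rewrite vy xy in xv.
have -> : #|S| * #|T| + (#|Y| - degree x) + (#|X| - degree y) = #|setX T S :|: M2 :|: M3|.
  rewrite [RHS]cardsU disj3 cards0 subn0 [in RHS]cardsU disj12 cards0 subn0.
  rewrite /M2 /M3 !cardsX !cards1 mul1n muln1 mulnC.
  by rewrite (cardsDS (nbr_sub XY xX)) (cardsDS NyX).
apply: subset_leq_card; apply/subsetP => -[u v]; rewrite !inE /=.
case/orP => [/orP[/andP[uT vS]|/and3P[/eqP-> xv ->]]|/andP[/andP[yu ->] /eqP->]].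
- by rewrite (TX _ uT) (SY _ vS) adj_sym noST.
- by rewrite xX.
- by rewrite yY adj_sym.
Qed.

Lemma no_cut_of_edges x y (S T : {set G}) : x \in X -> adj x y ->
  #|X| * #|Y| - edge_deficit #|X| #|Y| < #|edges G| ->
  S \subset [set z | adj x z] :\ y -> T \subset [set z | adj y z] :\ x ->
  (forall u v, u \in S -> v \in T -> ~~ adj u v) ->
  #|S| * degree y + #|T| * degree x < degree x * degree y.
Proof.
move=> xX xy many SA TB noST; rewrite ltnNge; apply/negP => cut.
have yY : y \in Y by apply: (subsetP (nbr_sub XY xX)); rewrite inE.
have := card_edges_cut xX xy SA TB noST.
have := @edge_deficit_le #|X| #|Y| (degree x) (degree y) #|S| #|T|.
have -> : degree x <= #|Y| by apply: subset_leq_card; exact: nbr_sub XY xX.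
have -> : degree y <= #|X| by apply: subset_leq_card; exact: nbr_sub (bipartitionC XY) yY.
(* The strict bounds required by [edge_deficit_le] come from [y] being a neighbour of [x] outside
   [S], and [x] one of [y] outside [T]. *)
have lt_deg (a b : G) (A : {set G}) : adj a b -> A \subset [set z | adj a z] :\ b -> #|A| < degree a.
  by move=> ab /subset_leq_card; rewrite /degree [X in _ -> _ < X](cardsD1 b) inE ab.
have yx : adj y x by rewrite adj_sym.
rewrite (lt_deg _ _ _ xy SA) (lt_deg _ _ _ yx TB) => /(_ isT isT isT isT cut).
move: many; lia.
Qed.

End EdgeCount.

(** * The extremal graphs *)

Section Extremal.
Import fintype boot.finset.
Local Open Scope set_scope.
Local Open Scope nat_scope.

Lemma card_ord_itv k a b : b <= k -> #|[set i : 'I_k | a <= i < b]| = b - a.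
Proof.
move=> bk; rewrite -[RHS]muln1 -sum_nat_const_nat (big_nat_widen _ _ _ _ _ bk).
rewrite (big_nat_widenl _ 0) // big_mkord -sum1dep_card.
by apply: eq_bigl => i; rewrite andbC.
Qed.

Variables (m n s : nat) (sparse : bool).

(* The missing edges between [1] and [1, ..., s] form the cut for the edge
   [(0, 0)]; [sparse] moreover brings the degree of [0] in the second part down
   to 2. *)
Definition extremal_joined (i j : nat) : bool :=
  ~~ ((i == 1) && (0 < j <= s) || [&& 1 < i, sparse & j == 0]).

Definition extremal_adj (u v : 'I_m + 'I_n) : bool :=
  match u, v with
  | inl i, inr j | inr j, inl i => extremal_joined i j
  | _, _ => false
  end.

Lemma extremal_adj_sym : symmetric extremal_adj.
Proof. by case=> i []. Qed.

Lemma extremal_adj_irrefl : irreflexive extremal_adj.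
Proof. by case. Qed.

Definition extremal_graph : sgraph := SGraph extremal_adj_sym extremal_adj_irrefl.

Definition extremal_X : {set extremal_graph} := inl @: [set: 'I_m].
Definition extremal_Y : {set extremal_graph} := inr @: [set: 'I_n].

Local Notation X := extremal_X.
Local Notation Y := extremal_Y.

Lemma extremal_bipartition : bipartition X Y.
Proof.
have inlY i : inl i \in Y = false by apply/negbTE/imsetP => -[].
have inrX j : inr j \in X = false by apply/negbTE/imsetP => -[].
have inlX i : inl i \in X by apply/imsetP; exists i.
have inrY j : inr j \in Y by apply/imsetP; exists j.
split.
- by apply/setP => -[i|j]; rewrite !inE ?inlX ?inrY ?orbT.
- by apply/pred0P => -[i|j] /=; rewrite ?inlY ?inrX ?andbF.
- by case=> [i|j] [i'|j'] //= _; [left|right].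
Qed.

Lemma card_extremal_parts : #|X| = m /\ #|Y| = n.
Proof. by split; rewrite card_imset ?cardsT ?card_ord // => ? ? []. Qed.

Hypotheses (m2 : 2 <= m) (sn : s < n).

Let x0 : 'I_m := Ordinal (ltnW m2).
Let x1 : 'I_m := Ordinal m2.
Let y0 : 'I_n := Ordinal (leq_ltn_trans (leq0n s) sn).

Lemma card_edges_extremal :
  #|edges extremal_graph| = m * n - (s + sparse * (m - 2)).
Proof.
have [cX cY] := card_extremal_parts.
have := card_missing_edges extremal_bipartition; rewrite cX cY => <-.
(* [M1] holds the missing edges at [x1], [M2] those at [y0]; the indices in the first part are 1 and
   at least 2 respectively, so they are disjoint. *)
pose M1 : {set extremal_graph * extremal_graph} :=
  setX [set inl x1] (inr @: [set j : 'I_n | 1 <= j < s.+1]).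
pose M2 : {set extremal_graph * extremal_graph} := if sparse then
  setX (inl @: [set i : 'I_m | 2 <= i < m]) [set inr y0] else set0.
have -> : [set p in setX X Y | ~~ adj p.1 p.2] = M1 :|: M2.
  apply/setP => -[u v]; apply/idP/idP.
    rewrite !inE /= => /andP[/andP[/imsetP[i _ ->] /imsetP[j _ ->]]].
    rewrite /= negbK => /orP[/andP[/eqP i1 js]|/and3P[i2 sp /eqP j0]]; apply/orP.
      left; rewrite (_ : i = x1); last exact: val_inj.
      by rewrite eqxx /=; apply/imsetP; exists j; rewrite ?inE.
    right; rewrite /M2 sp (_ : j = y0); last exact: val_inj.
    by rewrite !inE eqxx andbT; apply/imsetP; exists i; rewrite ?inE ?i2 /=.
  rewrite in_setU => /orP[|].
    rewrite !inE /= => /andP[/eqP-> /imsetP[j]]; rewrite inE => js ->.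
    by rewrite !imset_f ?inE //= /extremal_joined negbK js.
  rewrite /M2; case: ifP => [sp|_]; last by rewrite in_set0.
  rewrite !inE /= => /andP[/imsetP[i]]; rewrite inE => /andP[i2 _] -> /eqP->.
  by rewrite !imset_f ?inE //= /extremal_joined negbK sp i2 orbT.
rewrite cardsU (_ : M1 :&: M2 = set0) ?cards0 ?subn0; last first.
  apply/setP => -[u v]; rewrite in_setI in_set0 /M2; case: ifP => _; rewrite !inE ?andbF //=.
  apply/negP => /andP[/andP[/eqP-> _]] /andP[/imsetP[i]].
  by rewrite inE => /andP[i2 _] [i1]; rewrite -i1 in i2.
have -> : #|M1| = s.
  rewrite cardsX cards1 mul1n card_imset ?card_ord_itv ?subn1 //.
  by move=> ? ? [].
have -> : #|M2| = sparse * (m - 2).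
  rewrite /M2; case: ifP => _; rewrite ?cards0 // cardsX cards1 muln1 mul1n.
  by rewrite card_imset ?card_ord_itv // => ? ? [].
by rewrite addnK.
Qed.

(** For end degrees [p <= n] and [q], the cut inequality with [#|T| = 1] reads [p (q - 1) <= q s].
    It follows from [n (q - 1) <= q s], that is [q (n - s) <= n]. *)
Lemma kLLY_extremal (R : realType) : 1 < n ->
  (if sparse then 2 else m) * (n - s) <= n ->
  (kLLY R (inl x0 : extremal_graph) (inr y0 : extremal_graph) <= 0)%R.
Proof.
move=> n2 cut; have [cX cY] := card_extremal_parts.
have xX : (inl x0 : extremal_graph) \in X by apply/imsetP; exists x0.
pose S : {set extremal_graph} := inr @: [set j : 'I_n | 1 <= j < s.+1].
apply: (@kLLY_le0_of_cut _ _ _ _ extremal_bipartition _ _ S [set inl x1]) => //.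
- apply/subsetP => v /imsetP[j]; rewrite inE => /andP[j1 _] ->; rewrite !inE.
  by rewrite andbT; apply: contraTneq j1 => -[->].
- by apply/subsetP => v; rewrite !inE => /eqP->.
- move=> u v /imsetP[j]; rewrite inE => js -> /set1P ->.
  by rewrite /= negbK /= js.
- rewrite cards1 mul1n (_ : #|S| = s); last first.
    by rewrite card_imset ?card_ord_itv ?subn1 // => ? ? [].
  have px : degree (inl x0 : extremal_graph) <= n.
    apply: leq_trans (subset_leq_card (nbr_sub extremal_bipartition xX)) _.
    by rewrite cY.
  have qy : degree (inr y0 : extremal_graph) <= if sparse then 2 else m.
    have sub : (if sparse then 2 else m) <= m by case: sparse.
    have := card_ord_itv 0 sub; rewrite subn0 => <-.
    apply: leq_trans (leq_imset_card (inl : 'I_m -> extremal_graph) _).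
    apply: subset_leq_card; apply/subsetP => -[i|j]; rewrite inE // => /= ij.
    apply/imsetP; exists i => //; rewrite inE /=.
    by move: ij; rewrite /extremal_joined; case: sparse; case: i => [[|[|]]].
  have q0 : 0 < degree (inr y0 : extremal_graph) by apply: (@degree_gt0 extremal_graph _ (inl x0)).
  move: (degree _) (degree _) px qy q0 cut => q p; move: (if _ then _ else _).
  move=> k px qk q0 cut'.
  have qns : q * (n - s) <= n by apply: leq_trans (leq_mul qk (leqnn _)) cut'.
  have pq : p * (q - 1) <= n * (q - 1) by rewrite leq_mul2r px orbT.
  have qnE : q * n = q * s + q * (n - s) by rewrite -mulnDr subnKC // ltnW.
  by move: pq; rewrite !mulnBr; nia.
- by rewrite card_sum !card_ord; lia.
Qed.

End Extremal.

(** * Positivity above the edge threshold, and its sharpness *)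

Theorem theorem1p3 (R : realType) (m n : nat) (hm : (2 <= m)%N) (hmn : (m <= n)%N) :
  (forall (G : sgraph) (X Y : {set G}),
     bipartition X Y -> #|X| = m -> #|Y| = n ->
     (m * n - edge_deficit m n < #|edges G|)%N ->
     forall x y : G, adj x y -> (0 < kLLY R x y)%R)
  /\
  (exists (G : sgraph) (X Y : {set G}),
     [/\ bipartition X Y, #|X| = m, #|Y| = n,
         #|edges G| = (m * n - edge_deficit m n)%N &
         exists x y : G, adj x y /\ (kLLY R x y <= 0)%R]).
Proof.
split=> [G X Y XY <- <- many x y xy|].
  apply: (@kLLY_gt0_of_no_cut R G) => // S T SA TB noST.
  have [_ _ E] := XY; have [[xX _]|[_ yX]] := E _ _ xy.
    exact: (no_cut_of_edges XY).
  (* When [x] lies in [Y], the cut condition is used with [x], [y] and [S], [T] exchanged. *)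
  rewrite addnC [ltnRHS]mulnC; apply: (no_cut_of_edges XY) => //.
    by rewrite adj_sym.
  by move=> u v uT vS; rewrite adj_sym noST.
(* [s] is the least number with [k (n - s) <= n], where [k], the bound on the degree of [y0], is 2
   in the sparse case and [m] otherwise. *)
pose s := if (2 * m <= n)%N then uphalf n else (n - 1)%N.
pose sparse := (2 * m <= n)%N.
have sn : (s < n)%N by rewrite /s; case: ifP => _; lia.
have [cX cY] := card_extremal_parts m n s sparse.
exists (extremal_graph m n s sparse), (extremal_X m n s sparse), (extremal_Y m n s sparse).
split.
- exact: extremal_bipartition.
- exact: cX.
- exact: cY.
- rewrite card_edges_extremal // /edge_deficit /s /sparse; case: ifP => _; lia.
- do 2 eexists; split; last apply: (kLLY_extremal hm sn).
  + by [].
  + exact: leq_trans hmn.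
  + by rewrite /s /sparse; case: ifP => _; nia.
Qed.
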